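(* Let $n \ge 2$ be an integer and let $m \ge 0$ be an integer. (i) If $n = 3^m$, then $\operatorname{aw}_u([n],3) = \operatorname{aw}([n],3) = m+2$. (ii) If $n \neq 3^m$ and $7\cdot 3^{m-2}+1 \le n \le 21\cdot 3^{m-2}$, then $\operatorname{aw}_u([n],3) = \operatorname{aw}([n],3) = m+3$. (Here $3^{m-2}$ is understood as a rational number when $m<2$; every integer $n\ge 2$ falls under (i) or (ii) for some integer $m \ge 0$.)
   Context: For a positive integer $n$, $[n]=\{1,\ldots,n\}$. A $3$-term arithmetic progression ($3$-AP) in $[n]$ is a set $\{a,a+d,a+2d\}\subseteq [n]$ with $d\ge 1$. An $r$-coloring of $[n]$ is a function $c:[n]\to[r]$; it is exact if $c$ is surjective. A $3$-AP $\{a,a+d,a+2d\}$ is rainbow under $c$ if $c(a),c(a+d),c(a+2d)$ are pairwise distinct. An $r$-coloring is unitary if some element of $[n]$ is uniquely colored, i.e. there is $x\in[n]$ such that $c(y)\ne c(x)$ for all $y\in[n]$ with $y\neq x$. The anti-van der Waerden number $\operatorname{aw}([n],3)$ is the smallest positive integer $r$ such that every exact $r$-coloring of $[n]$ contains a rainbow $3$-AP; if $[n]$ contains no $3$-AP (i.e. $n\le 2$), then $\operatorname{aw}([n],3)=n+1$. The number $\operatorname{aw}_u([n],3)$ is the smallest integer $r\ge 2$ such that every exact unitary $r$-coloring of $[n]$ contains a rainbow $3$-AP; if $[n]$ contains no $3$-AP (i.e. $n\le 2$), then $\operatorname{aw}_u([n],3)=n+1$. *)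

(* Defs.v *)
From mathcomp Require Import all_boot.

Set Implicit Arguments.
Unset Strict Implicit.
Unset Printing Implicit Defensive.

(* The ordinal i : 'I_n stands for the element i + 1 of {1, ..., n}, and       *)
(* k : 'I_r for the color k + 1; arithmetic progressions are invariant under   *)
(* this shift.                                                                 *)
Notation coloring n r := {ffun 'I_n -> 'I_r}.

(* Ordering the progression {a, a + d, a + 2d} increasingly makes it a triple; *)
(* bounding d by n loses nothing, since a + 2d is an element of 'I_n.          *)
Definition AP3 n (x y z : 'I_n) : bool :=
  [exists d : 'I_n, [&& 0 < d, y == x + d :> nat & z == x + 2 * d :> nat]].

Definition has_rainbow_AP3 n r (c : coloring n r) : bool :=
  [exists x, exists y, exists z, AP3 x y z && uniq [:: c x; c y; c z]].

Definition exact n r (c : coloring n r) : bool :=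
  [forall k, exists x, c x == k].

Definition unitary n r (c : coloring n r) : bool :=
  [exists x, forall y, (y != x) ==> (c y != c x)].

Definition aw_pred n : pred nat := fun r =>
  (0 < r) && [forall c : coloring n r, exact c ==> has_rainbow_AP3 c].

Definition awu_pred n : pred nat := fun r =>
  (1 < r) && [forall c : coloring n r,
                exact c && unitary c ==> has_rainbow_AP3 c].

Lemma exactN n (c : coloring n n.+1) : ~~ exact c.
Proof.
apply/negP => /forallP ex_c.
suff: #|'I_n.+1| <= #|'I_n| by rewrite !card_ord ltnn.
apply: leq_trans (leq_image_card c 'I_n); apply/subset_leq_card/subsetP => k _.
by have /existsP[x /eqP <-] := ex_c k; apply: image_f.
Qed.

Lemma aw_ex n : exists r, aw_pred n r.
Proof.
by exists n.+1; apply/andP; split=> //; apply/forallP => c; rewrite (negPf (exactN c)).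
Qed.

Lemma awu_ex n : exists r, awu_pred n r.
Proof.
case: n => [|n].
  exists 2; apply/andP; split=> //; apply/forallP => c; apply/implyP => /andP[_].
  by case/existsP => -[].
by exists n.+2; apply/andP; split=> //; apply/forallP => c; rewrite (negPf (exactN c)).
Qed.

Definition aw n : nat := if n <= 2 then n.+1 else ex_minn (aw_ex n).

Definition awu n : nat := if n <= 2 then n.+1 else ex_minn (awu_ex n).

(* Main.v *)
Require Import Defs.
From mathcomp Require Import all_boot all_order all_algebra.
From mathcomp Require Import zify lra.

Import GRing.Theory Num.Theory.

(** Upper bound.  In a rainbow-free coloring, a shortest interval containing
    all the colors has both end points uniquely colored.  Shift it to
    0, ..., L.  Since neither end shares its color with an interior point, the
    progressions starting or ending there force L to be odd and the interior
    coloring to be invariant under doubling modulo L.  Call e fresh when its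
    color does not occur in 1, ..., e - 1.  A fresh e is odd, lies below L / 2,
    and the coloring of 1, ..., e - 1 is symmetric ([fresh_reflect]).  From
    this, fresh numbers g < e satisfy e = 3 g or e >= 5 g ([fresh_gap]), so
    that the fresh number preceded by exactly k colors is 3^k or at least
    (5 / 3) 3^k.  Applied to the last fresh number, which is less than
    L / 2, this gives the key estimate [framed_length]: with k + 2 interior
    colors, either L >= 9 * 3^k or L = 7 * 3^k.  In the latter case the
    coloring cannot be extended by 3^k points at either end, so it does not
    extend to an interval of 9 * 3^k points; this is why powers of three are
    exceptional ([rainbow_free_length]).

    Lower bound.  If x + z = 2 y, then as soon as one of x, y, z is not a
    multiple of 3 at least two of them are not.  Hence a rainbow-free coloring
    of the multiples of 3^k extends to all numbers by giving the others their
    3-adic valuation as color ([layered]).  Taking one color on the multiples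
    of 3^k, or two with 0 singled out, or the exceptional 4-coloring of eight
    points, yields unitary colorings with the required number of colors.

    Merging colors gives the smaller numbers of colors, and an exact unitary
    coloring is exact, so both anti-van der Waerden numbers are equal. *)

(** * Colors on intervals of natural numbers *)

Lemma pow3_gt0 k : 0 < 3 ^ k.
Proof. by rewrite expn_gt0. Qed.

(** The triples need not be increasing: degenerate and decreasing ones satisfy
    the condition automatically or by symmetry, and applications need no
    case distinction. *)
Definition rainbow_free n (c : nat -> nat) :=
  forall x y z, x < n -> z < n -> x + z = 2 * y ->
    [\/ c x = c y, c y = c z | c x = c z].

Definition ncolors (c : nat -> nat) a l := size (undup [seq c i | i <- iota a l]).

Lemma ncolorsSr c a l :
  ncolors c a l.+1 = ncolors c a l + (c (a + l) \notin [seq c i | i <- iota a l]).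
Proof.
rewrite /ncolors -addn1 iotaD map_cat cats1 /=.
rewrite (perm_size (perm_undup (mem_rcons _ _))) /=.
by case: ifP => _; rewrite ?addn0 ?addn1.
Qed.

Lemma ncolorsSl c a l :
  ncolors c a l.+1 = ncolors c a.+1 l + (c a \notin [seq c i | i <- iota a.+1 l]).
Proof. by rewrite /ncolors /=; case: ifP => _; rewrite ?addn0 ?addn1. Qed.

Lemma ncolors_gt0 c a l : 0 < ncolors c a l.+1.
Proof. by elim: l => // l; rewrite [ncolors c a l.+2]ncolorsSr; lia. Qed.

(** * Intervals with uniquely colored end points *)

(** The shape to which a shortest interval with all the colors reduces. *)
Definition framed L (c : nat -> nat) :=
  [/\ rainbow_free L.+1 c, c 0 <> c L
    & forall x, 0 < x < L -> c x <> c 0 /\ c x <> c L].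

Definition fresh L (c : nat -> nat) e :=
  0 < e < L /\ forall a, 0 < a < e -> c a <> c e.

Section Framed.

Variables (L : nat) (c : nat -> nat).
Hypothesis frc : framed L c.

(** By the progression 0, x, 2x, whose first color occurs nowhere else. *)
Lemma framed_double x : 0 < x -> 2 * x < L -> c (2 * x) = c x.
Proof.
move=> x0 xL; have [rf _ un] := frc.
have [|] := un x; first by lia.
have [|] := un (2 * x); first by lia.
by case: (rf 0 x (2 * x)); [lia|lia|lia|..]; congruence.
Qed.

(** By the progression 2x - L, x, L.  Together with [framed_double] this is
    invariance under doubling modulo L. *)
Lemma framed_double_wrap x : x < L -> L < 2 * x -> c (2 * x - L) = c x.
Proof.
move=> x0 xL; have [rf _ un] := frc.
have [|] := un x; first by lia.
have [|] := un (2 * x - L); first by lia.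
by case: (rf (2 * x - L) x L); [lia|lia|lia|..]; congruence.
Qed.

(** Otherwise 0, L / 2, L is rainbow. *)
Lemma framed_odd : 1 < L -> odd L.
Proof.
move=> L1; have [rf c0L un] := frc; case: (boolP (odd L)) => // evL.
have [|] := un L./2; first by lia.
by case: (rf 0 L./2 L); [lia|lia|lia|..]; congruence.
Qed.

Lemma fresh_le e a : fresh L c e -> 0 < a -> c a = c e -> e <= a.
Proof. by case=> _ He a0 E; rewrite leqNgt; apply/negP => lt; apply: (He a) E; lia. Qed.

(** Otherwise e has the same color as the smaller number 2e - L. *)
Lemma fresh_lt_half e : fresh L c e -> 2 * e < L.
Proof.
move=> fe; have [He _] := fe; have oL := framed_odd ltac:(lia).
have [//|lt] := ltnP (2 * e) L.
have /(fresh_le _ _ fe) := framed_double_wrap e ltac:(lia) ltac:(lia); lia.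
Qed.

Lemma fresh_odd e : fresh L c e -> odd e.
Proof.
move=> fe; have [He _] := fe; case: (boolP (odd e)) => // eve.
have E := framed_double e./2 ltac:(lia) ltac:(lia).
have := fresh_le _ e./2 fe ltac:(lia); rewrite -E.
have -> : 2 * e./2 = e by lia.
by move/(_ erefl); lia.
Qed.

Lemma fresh_even_le e a :
  fresh L c e -> 0 < a < L -> ~~ odd a -> c a = c e -> 2 * e <= a.
Proof.
move=> fe aL eva E; have := framed_double a./2 ltac:(lia) ltac:(lia).
have -> : 2 * a./2 = a by lia.
move=> d; have := fresh_le _ a./2 fe ltac:(lia) ltac:(congruence).
by lia.
Qed.

(** For odd a, the progression from a to e gives its middle the color of a,
    since e is fresh; doubling, a + e has that color too, and then so does e - a
    by the progression e - a, e, e + a.  For even a, exchange a and e - a. *)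
Lemma fresh_reflect e a : fresh L c e -> 0 < a < e -> c (e - a) = c a.
Proof.
move=> fe; have [He new] := fe; have Le := fresh_lt_half _ fe.
have oe := fresh_odd _ fe; have [rf _ _] := frc.
suff odd_case b : odd b -> 0 < b < e -> c (e - b) = c b.
  move=> ae; case: (boolP (odd a)) => oa; first exact: odd_case.
  have := odd_case (e - a) ltac:(lia) ltac:(lia).
  by have -> : e - (e - a) = a by lia.
move=> ob be.
have nb := new b be; have nm := new (b + e)./2 ltac:(lia).
have nr := new (e - b) ltac:(lia).
have mid : c (b + e)./2 = c b.
  by case: (rf b (b + e)./2 e); [lia|lia|lia|..]; congruence.
have := framed_double (b + e)./2 ltac:(lia) ltac:(lia).
have -> : 2 * (b + e)./2 = e + b by lia.
move=> dm.
by case: (rf (e - b) e (e + b)); [lia|lia|lia|..]; congruence.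
Qed.

(** Reflecting the multiples g, 2g, 4g of the color of g in e produces elements
    of that color, none of which may be smaller than g (or 2g if even): e - g
    shows that 3g <= e, then e - 4g excludes 4g < e < 5g, and if e < 4g then
    4g - e, the reflection of 2(e - 2g), excludes 3g < e. *)
Lemma fresh_gap g e :
  fresh L c g -> fresh L c e -> g < e -> e = 3 * g \/ 5 * g <= e.
Proof.
move=> fg fe ge; have [Hg _] := fg; have [He _] := fe.
have Le := fresh_lt_half _ fe; have oe := fresh_odd _ fe.
have og := fresh_odd _ fg.
have e3g : 3 * g <= e.
  have r1 := fresh_reflect e g fe ltac:(lia).
  have := fresh_even_le _ (e - g) fg ltac:(lia) ltac:(lia) r1; lia.
have c2 := framed_double g ltac:(lia) ltac:(lia).
have [lt4|ge4] := ltnP e (4 * g); [left|right].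
  have r2 := fresh_reflect e (2 * g) fe ltac:(lia).
  have d2 := framed_double (e - 2 * g) ltac:(lia) ltac:(lia).
  have r3 := fresh_reflect e (2 * (e - 2 * g)) fe ltac:(lia).
  have := fresh_le _ (e - 2 * (e - 2 * g)) fg ltac:(lia).
  by rewrite r3 d2 r2 c2 => /(_ erefl); lia.
have c4 := framed_double (2 * g) ltac:(lia) ltac:(lia).
have r4 := fresh_reflect e (2 * (2 * g)) fe ltac:(lia).
have := fresh_le _ (e - 2 * (2 * g)) fg ltac:(lia).
by rewrite r4 c4 c2 => /(_ erefl); lia.
Qed.

(** The largest fresh number below x is preceded by one color fewer. *)
Lemma last_fresh x : x <= L -> 0 < ncolors c 1 x.-1 ->
  exists g, [/\ g < x, fresh L c g & ncolors c 1 x.-1 = (ncolors c 1 g.-1).+1].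
Proof.
elim: x => [|[|x] IH] // xL.
rewrite /= ncolorsSr add1n.
case: (boolP (_ \in _)) => [/= _|nin _].
  rewrite addn0 => /(IH ltac:(lia))[g [gx fg E]].
  by exists g; split => //; lia.
exists x.+1; split; [by []| |by rewrite addn1].
split; first by lia.
move=> a ax E; move/negP: nin; apply; rewrite -E; apply: map_f.
rewrite mem_iota; lia.
Qed.

(** A single step of [fresh_gap] with ratio at least 5 costs the factor 5 / 3. *)
Lemma fresh_pow3 e k : fresh L c e -> ncolors c 1 e.-1 = k ->
  (e = 3 ^ k /\ forall j, j < k -> fresh L c (3 ^ j)) \/ 5 * 3 ^ k <= 3 * e.
Proof.
elim: k e => [|k IH] e fe Ek; have [He _] := fe.
  left; split=> //; rewrite expn0.
  case: e fe He Ek => [|[|e]] fe He //.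
  by have := ncolors_gt0 c 1 e; rewrite /=; lia.
have [g [ge fg]] := last_fresh e ltac:(lia) ltac:(by rewrite Ek).
rewrite Ek => -[/esym Eg].
have := fresh_gap _ _ fg fe ge; rewrite expnS.
have [[Eg3 fj]|] := IH _ fg Eg; last by right; lia.
case=> [e3|]; last by right; lia.
left; split; first by lia.
move=> j; rewrite ltnS leq_eqVlt => /orP[/eqP->|/fj //].
by rewrite -Eg3.
Qed.

(** For the last fresh number e, the bound 2e < L settles the claim unless
    e = 3 * 3^k.  The values 6 * 3^k < L < 9 * 3^k other than 7 * 3^k are then
    excluded by following the orbit of 3^k (or of 3^(k-1)) under doubling modulo L.  The
    inequality of colors recorded for L = 7 * 3^k prevents extensions. *)
Lemma framed_length k : ncolors c 1 L.-1 = k.+2 ->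
  9 * 3 ^ k <= L \/ L = 7 * 3 ^ k /\ c (3 ^ k) <> c (3 * 3 ^ k).
Proof.
move=> EL; have [|e [eL fe]] := last_fresh L (leqnn L); first by rewrite EL.
rewrite EL => -[/esym Ee].
have := fresh_pow3 e _ fe Ee; rewrite expnS.
have Le := fresh_lt_half _ fe.
have u0 := pow3_gt0 k.
have [He newe] := fe.
have oL := framed_odd ltac:(lia).
case=> [[Ee3 fj]|]; last by left; lia.
have fg := fj k (ltnSn k); have og := fresh_odd _ fg.
have [ge9|lt9] := leqP (9 * 3 ^ k) L; [by left | right].
suff E7 : L = 7 * 3 ^ k by split=> //; rewrite -Ee3; apply: newe; lia.
set g := 3 ^ k in u0 Ee3 fg og lt9 *.
have c2 := framed_double g ltac:(lia) ltac:(lia).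
have c4 := framed_double (2 * g) ltac:(lia) ltac:(lia).
have [lt8|ge8] := ltnP L (8 * g).
  (* The color of g recurs at x = 8g - L < 2g.  An x below g contradicts    *)
  (* freshness of g at once, an x above g does so after reflection in e.    *)
  have c8 := framed_double_wrap (2 * (2 * g)) ltac:(lia) ltac:(lia).
  set x := _ - L in c8; have Ex : x = 8 * g - L by rewrite /x; lia.
  have cx : c x = c g by congruence.
  have gx := fresh_le _ x fg ltac:(lia) cx.
  have [//|ne7] := eqVneq L (7 * g).
  have r := fresh_reflect e x fe ltac:(lia).
  have := fresh_even_le _ (e - x) fg ltac:(lia) ltac:(lia) ltac:(congruence).
  by lia.
case: k => [|k] in EL Ee fj @g u0 Ee3 fg og lt9 c2 c4 ge8 *.
  by rewrite /g expn0 in lt9 ge8; lia.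
have ff := fj k ltac:(lia).
have Eg : g = 3 * 3 ^ k by rewrite /g expnS.
clearbody g; set f := 3 ^ k in Eg ff.
have [f0 _] := ff; have of' := fresh_odd _ ff.
(* Now e = 9f and 24f < L < 27f.  Reflecting 2f in e gives 7f, and doubling *)
(* 7f twice modulo L gives an odd x = 28f - L with f < x < 4f whose color   *)
(* is that of f; wherever x lies, reflections produce an even number too    *)
(* small to have that color.                                                *)
have d2 := framed_double f ltac:(lia) ltac:(lia).
have r7 := fresh_reflect e (2 * f) fe ltac:(lia).
have d14 := framed_double (e - 2 * f) ltac:(lia) ltac:(lia).
have d28 := framed_double_wrap (2 * (e - 2 * f)) ltac:(lia) ltac:(lia).
set x := _ - L in d28; have Ex : x = 28 * f - L by rewrite /x; lia.
have cx : c x = c f by congruence.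
clearbody x.
have [E|nex] := eqVneq x g.
  by have [_ newg] := fg; case: (newg f); [lia | rewrite -E cx].
have [ltg|gtg] := ltnP x g.
  have r := fresh_reflect g x fg ltac:(lia).
  have := fresh_even_le _ (g - x) ff ltac:(lia) ltac:(lia) ltac:(congruence).
  by lia.
have r := fresh_reflect e x fe ltac:(lia).
have := framed_double (e - x)./2 ltac:(lia) ltac:(lia).
have -> : 2 * (e - x)./2 = e - x by lia.
move=> d; have r' := fresh_reflect g (e - x)./2 fg ltac:(lia).
have := fresh_le _ (g - (e - x)./2) ff ltac:(lia) ltac:(congruence).
by lia.
Qed.

End Framed.

(** * The upper bound *)

(** In an interval of least length with enough colors, removing either end
    point loses a color, so the end points are uniquely colored. *)
Lemma shortest_frame n c r : rainbow_free n c -> r.+2 <= ncolors c 0 n ->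
  exists a L, [/\ a + L < n, framed L (fun i => c (a + i))
    & ncolors (fun i => c (a + i)) 1 L.-1 = r].
Proof.
move=> rf rn.
pose wide l := [exists a : 'I_n.+1, (a + l <= n) && (r.+2 <= ncolors c a l)].
have ex_wide : exists l, wide l.
  by exists n; apply/existsP; exists ord0; rewrite add0n leqnn.
case: (ex_minnP ex_wide) => l /existsP[[a /= _] /andP[al rl]] minl.
have narrow b k : k < l -> b + k <= n -> ncolors c b k < r.+2.
  move=> kl bk; rewrite ltnNge; apply/negP => rk.
  suff: wide k by move/minl; lia.
  have bn : b < n.+1 by lia.
  by apply/existsP; exists (Ordinal bn); rewrite bk.
case: l => [|[|l]] in al rl minl narrow *; try by [].
have nr := narrow a.+1 l.+1 ltac:(lia) ltac:(lia).
have nl := narrow a l.+1 ltac:(lia) ltac:(lia).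
have left_new : c a \notin [seq c i | i <- iota a.+1 l.+1].
  by move: rl; rewrite ncolorsSl; case: (_ \notin _) => //=; lia.
have right_new : c (a + l.+1) \notin [seq c i | i <- iota a l.+1].
  by move: rl; rewrite ncolorsSr; case: (_ \notin _) => //=; lia.
have mem b k i : b <= i < b + k -> c i \in [seq c i | i <- iota b k].
  by move=> bik; apply: map_f; rewrite mem_iota.
have shift : ncolors (fun i => c (a + i)) 1 l = ncolors c a.+1 l.
  by rewrite /ncolors -[a.+1]addn1 iotaDl -map_comp.
exists a, l.+1; split; first by lia.
- split.
  + move=> x y z xl zl xyz.
    by have := rf (a + x) (a + y) (a + z) ltac:(lia) ltac:(lia) ltac:(lia).
  + by move=> E; move/negP: right_new; apply; rewrite -E; apply: mem; lia.
  + move=> x xl; split=> E.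
      by move/negP: left_new; apply; rewrite -[a]addn0 -E; apply: mem; lia.
    by move/negP: right_new; apply; rewrite -E; apply: mem; lia.
- rewrite /= shift.
  have : c (a.+1 + l) \notin [seq c i | i <- iota a.+1 l].
    apply: contra right_new; rewrite addSnnS => /mapP[i].
    by rewrite mem_iota => il ->; apply: mem; lia.
  move: rl nr; rewrite ncolorsSl left_new ncolorsSr => + + nin.
  by rewrite nin; lia.
Qed.

(** When n = 9 * 3^k, the framed interval has length L = 7 * 3^k =: 7u, and at
    least u of the other points lie on the same side of it.  At distance u to
    the left of 0, the progressions (-u, 0, u) and (-u, 3u, 7u) leave no color;
    at distance u to the right of L, so do (0, 4u, 8u) and (6u, 7u, 8u). *)
Lemma rainbow_free_length n c k : rainbow_free n c -> k + 4 <= ncolors c 0 n ->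
  7 * 3 ^ k < n /\ n <> 9 * 3 ^ k.
Proof.
move=> rf; rewrite addnC => /(shortest_frame _ _ _ rf)[a [L [aL fr EL]]].
have u0 := pow3_gt0 k.
have [|[E7 ne]] := framed_length _ _ fr _ EL; first by lia.
split; first by lia.
set u := 3 ^ k in u0 E7 ne * => n9.
have d4 := framed_double _ _ fr u ltac:(lia) ltac:(lia).
have d4' := framed_double _ _ fr (2 * u) ltac:(lia) ltac:(lia).
have d6 := framed_double _ _ fr (3 * u) ltac:(lia) ltac:(lia).
have [_ n0L un] := fr.
have [n1 n1'] := un u ltac:(lia); have [n3 n3'] := un (3 * u) ltac:(lia).
rewrite E7 /= in n0L n1' n3' *.
rewrite /= addn0 in n0L n1 n3 d4 d4' d6 ne *.
have [au|au] := leqP u a.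
  have h1 := rf (a - u) (a + 3 * u) (a + 7 * u) ltac:(lia) ltac:(lia) ltac:(lia).
  have h2 := rf (a - u) a (a + u) ltac:(lia) ltac:(lia) ltac:(lia).
  by case: h1 => ?; case: h2 => ?; congruence.
have h1 := rf a (a + 2 * (2 * u)) (a + 8 * u) ltac:(lia) ltac:(lia) ltac:(lia).
have h2 := rf (a + 2 * (3 * u)) (a + 7 * u) (a + 8 * u)
  ltac:(lia) ltac:(lia) ltac:(lia).
by case: h1 => ?; case: h2 => ?; congruence.
Qed.

(** * Colorings by 3-adic valuation *)

(** The 3-adic valuation of x if this is less than k, and otherwise k plus the
    color given by phi to the quotient of x by 3^k. *)
Fixpoint layered (phi : nat -> nat) k x :=
  if k is k'.+1 then if 3 %| x then (layered phi k' (x %/ 3)).+1 else 0 else phi x.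

Lemma layered_mul phi k y : layered phi k (3 ^ k * y) = k + phi y.
Proof.
elim: k => [|k IH] /=; first by rewrite mul1n.
by rewrite expnS -mulnA dvdn_mulr // mulKn // IH.
Qed.

Lemma layered_add phi k b j : j < k -> layered phi k (3 ^ k * b + 3 ^ j) = j.
Proof.
elim: k j => [|k IH] // [|j] jk /=.
  by rewrite expnS -mulnA dvdn_addr ?dvdn_mulr.
by rewrite !expnS -!mulnA -mulnDr dvdn_mulr // mulKn // IH.
Qed.

Lemma layered_ge phi k x : k <= layered phi k x -> exists y, x = 3 ^ k * y.
Proof.
elim: k x => [|k IH] x /=; first by exists x; rewrite mul1n.
case: ifP => // /dvdnP[y ->]; rewrite mulnK // ltnS => /IH[z ->].
by exists z; rewrite expnS; lia.
Qed.

(** At each layer, a progression with a term not divisible by 3 has two such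
    terms, and these have the same color. *)
Lemma layered_rainbow_free phi k x y z : x + z = 2 * y ->
  (forall x' y' z', x = 3 ^ k * x' -> y = 3 ^ k * y' -> z = 3 ^ k * z' ->
     [\/ phi x' = phi y', phi y' = phi z' | phi x' = phi z']) ->
  let c := layered phi k in [\/ c x = c y, c y = c z | c x = c z].
Proof.
elim: k x y z => [|k IH] x y z xyz rf /=; first by apply: rf; rewrite mul1n.
case: ifP => [/dvdnP[x' Ex]|nx]; case: ifP => [/dvdnP[y' Ey]|ny];
  case: ifP => [/dvdnP[z' Ez]|nz]; try by [constructor 1|constructor 2|constructor 3].
- subst; rewrite !mulnK //.
  have := IH x' y' z' ltac:(lia).
  case=> [x1 y1 z1 E1 E2 E3|E|E|E].
  + by apply: rf; rewrite expnS; lia.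
  + by constructor 1; rewrite E.
  + by constructor 2; rewrite E.
  + by constructor 3; rewrite E.
- by exfalso; move/negP: nz; apply; apply/dvdnP; exists (2 * y' - x'); lia.
- by exfalso; move/negP: ny; apply; apply/dvdnP; exists (y - x' - z'); lia.
- by exfalso; move/negP: nx; apply; apply/dvdnP; exists (2 * y' - z'); lia.
Qed.

(** The uniquely colored element has the largest color, so that merging the
    smallest colors keeps it unique. *)
Definition unitary_witness n r (c : nat -> nat) :=
  [/\ forall i, i < n -> c i < r, forall v, v < r -> exists2 i, i < n & c i = v,
      rainbow_free n c
    & exists2 i0, i0 < n & forall i, i < n -> (c i == r.-1) = (i == i0)].

(** The interval s, ..., s + n - 1 has to contain 3^k b + 3^j for every j < k in
    order that the colors below k occur. *)
Lemma layered_witness n s k q phi y0 b : 0 < q ->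
  s <= 3 ^ k * y0 < s + n -> phi y0 = q.-1 ->
  (forall y, s <= 3 ^ k * y < s + n -> phi y < q /\ (phi y = q.-1 -> y = y0)) ->
  (forall v, v < q -> exists2 y, s <= 3 ^ k * y < s + n & phi y = v) ->
  (forall x y z, s <= 3 ^ k * x < s + n -> s <= 3 ^ k * z < s + n ->
     x + z = 2 * y -> [\/ phi x = phi y, phi y = phi z | phi x = phi z]) ->
  (forall j, j < k -> s <= 3 ^ k * b + 3 ^ j < s + n) ->
  unitary_witness n (k + q) (fun i => layered phi k (i + s)).
Proof.
move=> q0 y0n phiy0 phiq phiE rf colk.
have k0 := pow3_gt0 k.
split.
- move=> i ni; rewrite ltnNge; apply/negP => ge.
  have [y Ey] : exists y, i + s = 3 ^ k * y by apply: (layered_ge phi); lia.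
  by move: ge; rewrite Ey layered_mul; have [] := phiq y ltac:(lia); lia.
- move=> v vr; have [vk|kv] := ltnP v k.
    have := colk v vk => vn; exists (3 ^ k * b + 3 ^ v - s); first by lia.
    by rewrite subnK ?layered_add //; lia.
  have [y yn Ey] := phiE (v - k) ltac:(lia).
  exists (3 ^ k * y - s); first by lia.
  by rewrite subnK ?layered_mul ?Ey; lia.
- move=> x y z xn zn xyz; apply: layered_rainbow_free; first by lia.
  by move=> x' y' z' Ex Ey Ez; apply: rf; [lia|lia|nia].
- exists (3 ^ k * y0 - s); first by lia.
  move=> i ni; apply/eqP/eqP => [E|->]; last by rewrite subnK ?layered_mul; lia.
  have [y Ey] : exists y, i + s = 3 ^ k * y by apply: (layered_ge phi); lia.
  have [_ yy0] := phiq y ltac:(lia).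
  by rewrite -yy0; [lia | move: E; rewrite Ey layered_mul; lia].
Qed.

Lemma ltn_pow3 j k : j < k -> 3 ^ j < 3 ^ k.
Proof. by rewrite ltn_exp2l. Qed.

Lemma witness_pow3 m : exists c, unitary_witness (3 ^ m) m.+1 c.
Proof.
have k0 := pow3_gt0 m.
exists (fun i => layered (fun=> 0) m (i + 1)); rewrite -(addn1 m).
apply: (@layered_witness (3 ^ m) 1 m 1 (fun=> 0) 1 0) => //.
- by lia.
- by move=> y yn; split=> // _; nia.
- by case=> // _; exists 1 => //; lia.
- by constructor 1.
- by move=> j /ltn_pow3; have := pow3_gt0 j; lia.
Qed.

Lemma witness_gt_pow3 m n : 3 ^ m < n -> n <= 3 * 3 ^ m ->
  exists c, unitary_witness n m.+2 c.
Proof.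
have k0 := pow3_gt0 m.
move=> mn nm.
pose phi y : nat := y == 0.
exists (fun i => layered phi m (i + 0)); rewrite -(addn2 m).
apply: (@layered_witness n 0 m 2 phi 0 0) => //.
- by lia.
- by move=> [|y].
- by case=> [|[|]] // _; [exists 1 => //; lia | exists 0 => //; lia].
- by move=> x y z xn zn xyz; case: x z y xyz {xn zn} => [|x] [|z] [|y] /= xyz;
    (by constructor 1) || (by constructor 2) || (by constructor 3) || lia.
- by move=> j /ltn_pow3; lia.
Qed.

(** The 4-coloring of 1, ..., 8 is exceptional in that it has one color more
    than valuations provide: its end points are uniquely colored, and a point y
    between them is colored according to whether y - 1 is a square modulo 7. *)
Definition octet y := nth 0 [:: 0; 2; 0; 0; 1; 0; 1; 1; 3] y.

(** The shift s makes 3^k, ..., 8 * 3^k the multiples of 3^k in the interval;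
    such a shift exists exactly because 7 * 3^k < n < 9 * 3^k. *)
Lemma witness_lt_pow3 k n : 7 * 3 ^ k < n -> n < 9 * 3 ^ k ->
  exists c, unitary_witness n (k + 4) c.
Proof.
have k0 := pow3_gt0 k.
move=> n7 n9; pose s := minn (3 ^ k) (9 * 3 ^ k - n).
have range y : (s <= 3 ^ k * y < s + n) = (0 < y < 9) by rewrite /s; nia.
exists (fun i => layered octet k (i + s)).
apply: (@layered_witness n s k 4 octet 8 1) => //.
- by move=> y; rewrite range; case: y => [|[|[|[|[|[|[|[|[|]]]]]]]]].
- by case=> [|[|[|[|]]]] // _; [exists 2|exists 4|exists 1|exists 8] => //;
    rewrite range.
- move=> x y z; rewrite !range => xn zn xyz.
  have chk : all (fun x => all (fun z => let y := (x + z)./2 in ~~ odd (x + z) ==>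
      [|| octet x == octet y, octet y == octet z
        | octet x == octet z]) (iota 1 8)) (iota 1 8) by [].
  have /allP/(_ z) := allP chk x ltac:(rewrite mem_iota; lia).
  rewrite mem_iota; have -> : (x + z)./2 = y by lia.
  move/(_ ltac:(lia)); have -> : ~~ odd (x + z) by lia.
  case/or3P => /eqP; by [constructor 1|constructor 2|constructor 3].
- by move=> j /ltn_pow3; rewrite /s; lia.
Qed.

(** Truncated subtraction of r - r' merges the smallest colors. *)
Lemma merge_witness n r r' c : unitary_witness n r c -> 0 < r' <= r ->
  exists c' : coloring n r',
    [/\ exact c', 1 < r' -> unitary c' & ~~ has_rainbow_AP3 c'].
Proof.
case=> cr cE rf [i0 i0n cu] r'r.
have lt i : i < n -> c i - (r - r') < r' by move/cr; lia.
pose c' : coloring n r' := [ffun i : 'I_n => Ordinal (lt i (ltn_ord i))].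
have c'E i : c' i = c i - (r - r') :> nat by rewrite ffunE.
exists c'; split.
- apply/forallP => v; have [i ni Ei] := cE (v + (r - r')) ltac:(have := ltn_ord v; lia).
  by apply/existsP; exists (Ordinal ni); apply/eqP/val_inj; rewrite /= c'E /= Ei; lia.
- move=> r'1; apply/existsP; exists (Ordinal i0n); apply/forallP => i.
  apply/implyP => ne; apply/negP => /eqP/(congr1 val) /=; rewrite !c'E /=.
  have /eqP -> : c i0 == r.-1 by rewrite cu.
  have : c i != r.-1 by rewrite cu //.
  have := cr i (ltn_ord i); lia.
- apply/existsP => -[x /existsP[y /existsP[z /andP[]]]].
  case/existsP => d /and3P[d0 /eqP Ey /eqP Ez].
  rewrite /= !inE -!val_eqE /= !c'E.
  case: (rf x y z) => //; first by lia.
  + by move=> ->; rewrite eqxx.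
  + by move=> ->; rewrite eqxx andbF.
  + by move=> ->; rewrite eqxx orbT.
Qed.

(** * The anti-van der Waerden numbers *)

Lemma exact_rainbow_free n r (c : coloring n r) : exact c -> ~~ has_rainbow_AP3 c ->
  exists c', rainbow_free n c' /\ r <= ncolors c' 0 n.
Proof.
move=> exc nrb; pose c' i := if insub i is Some j then c j : nat else 0.
have c'E (i : 'I_n) : c' i = c i by rewrite /c' valK.
have rf x y z : x < y < n -> z < n -> x + z = 2 * y ->
    [\/ c' x = c' y, c' y = c' z | c' x = c' z].
  move=> xn zn xyz; have x_n : x < n by lia. have y_n : y < n by lia.
  have d_n : y - x < n by lia.
  have /existsPn/(_ (Ordinal x_n))/existsPn/(_ (Ordinal y_n)) := nrb.
  move/existsPn/(_ (Ordinal zn)).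
  rewrite (c'E (Ordinal x_n)) (c'E (Ordinal y_n)) (c'E (Ordinal zn)).
  have -> : AP3 (Ordinal x_n) (Ordinal y_n) (Ordinal zn).
    by apply/existsP; exists (Ordinal d_n) => /=; lia.
  rewrite /= !inE andbT negb_and !negbK.
  case/orP => [|/eqP-> ]; last by constructor 2.
  by case/orP => /eqP ->; [constructor 1 | constructor 3].
exists c'; split.
  move=> x y z xn zn xyz; have [xy|yx|->] := ltngtP x y.
  + by apply: rf; lia.
  + by case: (rf z y x) => [|||E|E|E]; try lia;
      [constructor 2|constructor 1|constructor 3].
  + by constructor 1.
rewrite -{1}(size_iota 0 r); apply: uniq_leq_size; first exact: iota_uniq.
move=> v; rewrite mem_iota mem_undup => /= vr.
have /forallP/(_ (Ordinal vr))/existsP[i /eqP Ei] := exc.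
by apply/mapP; exists (val i); rewrite ?mem_iota ?c'E ?Ei //=; have := ltn_ord i; lia.
Qed.

Lemma aw_eq n r : 2 < n -> 0 < r -> (exists c, unitary_witness n r c) ->
  (forall c, rainbow_free n c -> ncolors c 0 n <= r) ->
  awu n = aw n /\ aw n = r.+1.
Proof.
move=> n2 r0 [c wc] ub.
have aw_r : aw_pred n r.+1.
  apply/andP; split=> //; apply/forallP => c'; apply/implyP => exc.
  apply: contraT => /(exact_rainbow_free _ _ _ exc)[c'' [/ub]]; lia.
have awu_r : awu_pred n r.+1.
  case/andP: aw_r => _ /forallP all_r; apply/andP; split=> //.
  by apply/forallP => c'; apply/implyP => /andP[/(implyP (all_r c'))].
have lb q : 0 < q <= r -> ~~ aw_pred n q /\ ~~ awu_pred n q.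
  case/(merge_witness _ _ _ _ wc) => c' [exc unc nrb].
  split; apply/negP => /andP[q1 /forallP/(_ c')].
    by rewrite exc (negPf nrb).
  by rewrite exc (unc q1) (negPf nrb).
suff [-> ->] : aw n = r.+1 /\ awu n = r.+1 by [].
rewrite /aw /awu leqNgt n2 /=; split.
  case: ex_minnP => q awq /(_ _ aw_r) qr; case/andP: (awq) => q0 _.
  have [|lt] := ltnP r q; first by lia.
  by have [] := lb q ltac:(lia); rewrite awq.
case: ex_minnP => q awq /(_ _ awu_r) qr; case/andP: (awq) => q1 _.
have [|lt] := ltnP r q; first by lia.
by have [] := lb q ltac:(lia); rewrite awq.
Qed.

Theorem aw_pow3 m : 0 < m ->
  awu (3 ^ m) = aw (3 ^ m) /\ aw (3 ^ m) = m + 2.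
Proof.
move=> m0; rewrite addn2; apply: aw_eq => //.
- by rewrite -{1}[2]/(3 ^ 1).-1 prednK // leq_exp2l.
- exact: witness_pow3.
move=> c rf; rewrite leqNgt; apply/negP => nc.
case: m => [|[|k]] // in m0 rf nc *.
  have [a [L [aL fr EL]]] := shortest_frame _ _ 1 rf nc.
  have := framed_odd _ _ fr; move: EL; rewrite expn1 in aL.
  by case: L {fr} aL => [|[|[|L]]] //; lia.
by have [] := rainbow_free_length _ _ k rf ltac:(lia); rewrite !expnS; lia.
Qed.

Theorem aw_not_pow3 m n : 2 < n -> n <> 3 ^ m -> 7 * 3 ^ m + 9 <= 9 * n ->
  3 * n <= 7 * 3 ^ m -> awu n = aw n /\ aw n = m + 3.
Proof.
move=> n2 nm lo hi.
have -> : m + 3 = m.+2.+1 by lia.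
case: m => [|k] in nm lo hi *; first by lia.
apply: aw_eq => //.
  have [lt|ge] := ltnP n (3 ^ k.+1); last by apply: witness_gt_pow3; lia.
  case: k => [|k] in nm lo hi lt *; first by rewrite expn1 in lt lo; lia.
  have -> : k.+4 = k + 4 by lia.
  by apply: witness_lt_pow3; move: lo lt; rewrite !expnS; lia.
move=> c rf; rewrite leqNgt; apply/negP => nc.
have [] := rainbow_free_length _ _ k rf ltac:(lia); move: hi; rewrite expnS; lia.
Qed.

Lemma pow3_scale n : 2 <= n -> exists m,
  n = 3 ^ m \/ (n <> 3 ^ m /\ 7 * 3 ^ m + 9 <= 9 * n /\ 3 * n <= 7 * 3 ^ m).
Proof.
move=> n2.
have ex_m : exists m, 3 * n <= 7 * 3 ^ m.
  by exists n; have := ltn_expl n (isT : 1 < 3); lia.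
case: (ex_minnP ex_m) => m hi minm; exists m.
have [|/eqP ne] := eqVneq n (3 ^ m); [by left | right; split=> //; split=> //].
case: m => [|m] in hi minm ne *; first by rewrite expn0 in hi *; lia.
have lt : 7 * 3 ^ m < 3 * n by rewrite ltnNge; apply/negP => /minm; lia.
case: m => [|m] in hi minm ne lt *; first by rewrite expn1 in hi ne *; lia.
by move: lt; rewrite !expnS; lia.
Qed.

Lemma pow3_rat_scale m :
  (3%:Q ^ (m%:Z - 2) = ((3 ^ m)%N%:R : rat) / 9%:R)%R.
Proof. by rewrite expfzDr // -exprnP natrX. Qed.

Lemma rat_lower_bound (m n : nat) :
  (7%:Q * 3%:Q ^ (m%:Z - 2) + 1 <= n%:Q)%R = (7 * 3 ^ m + 9 <= 9 * n).
Proof.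
rewrite pow3_rat_scale -(ler_nat rat) natrD !natrM -[(n%:Q)%R]/(n%:R)%R.
by apply/idP/idP; lra.
Qed.

Lemma rat_upper_bound (m n : nat) :
  (n%:Q <= 21%:Q * 3%:Q ^ (m%:Z - 2))%R = (3 * n <= 7 * 3 ^ m).
Proof.
rewrite pow3_rat_scale -(ler_nat rat) !natrM -[(n%:Q)%R]/(n%:R)%R.
by apply/idP/idP; lra.
Qed.

Theorem theorem2 (n : nat) (hn : (2 <= n)%N) :
  (forall m : nat,
    (n = (3 ^ m)%N -> awu n = aw n /\ aw n = (m + 2)%N) /\
    (n <> (3 ^ m)%N ->
     (7%:Q * 3%:Q ^ (m%:Z - 2) + 1 <= n%:Q)%R ->
     (n%:Q <= 21%:Q * 3%:Q ^ (m%:Z - 2))%R ->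
     awu n = aw n /\ aw n = (m + 3)%N)) /\
  (exists m : nat,
    n = (3 ^ m)%N \/
    (n <> (3 ^ m)%N /\
     (7%:Q * 3%:Q ^ (m%:Z - 2) + 1 <= n%:Q)%R /\
     (n%:Q <= 21%:Q * 3%:Q ^ (m%:Z - 2))%R)).
Proof.
split=> [m|]; last first.
  have [m Em] := pow3_scale n hn; exists m.
  by rewrite rat_lower_bound rat_upper_bound.
rewrite rat_lower_bound rat_upper_bound; split=> [E|ne lo hi].
  by rewrite E; apply: aw_pow3; case: m E => // E; rewrite E in hn.
have [n2|n2] := ltnP 2 n; first exact: aw_not_pow3.
case: m => [|m] in ne lo hi *; last first.
  by move: lo; rewrite expnS; have := pow3_gt0 m; lia.
have -> : n = 2 by lia.
by [].
Qed.
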